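(* Consider the game with $n\ge2$ senders described in the context, suppose $c<\bar v(\tilde\omega_i\mid\boldsymbol\omega_{-i})$ for all $i\in N$ and all $\boldsymbol\omega_{-i}$ in the support of $\mu^0$, and suppose the senders' components are substitutes. Let $(\lambda_i^*(\mu^t))_{t\ge0}$ be the offer process of sender $i$ in an AoN equilibrium. Then, while sender $i$'s component remains unknown (has not been revealed), $$\mathbb E^t\left[\lambda_i^*(\mu^{t+1})\right]\ \ge\ \lambda_i^*(\mu^t),$$ where $\mathbb E^t$ denotes expectation conditional on the public information at the beginning of round $t$.
   Context: **State and decision problem.** There are one receiver and $n$ senders $i\in N=\{1,\dots,n\}$. The state $\boldsymbol\omega=(\omega_0,\omega_1,\dots,\omega_n)$ lies in a Polish space $\Omega=\Omega_0\times\dots\times\Omega_n$, is constant over time, and is drawn from a common prior $\mu^0\in\Delta(\Omega)$; components may be correlated. Sender $i$ can reveal information about $\omega_i$; no sender can directly reveal $\omega_0$. Write $\boldsymbol\omega_{-i}=(\omega_j)_{j\in N,\,j\ne i}$ (excluding $\omega_0$) and $\boldsymbol\omega_S=(\omega_j)_{j\in S}$ for $S\subset N$. The receiver has a closed action space $A$ and continuous bounded utility $u:A\times\Omega\to\mathbb R$ for which optimal actions exist. **Game.** Rounds $t=0,1,2,\dots$. In each round, if the receiver has not stopped, all senders simultaneously offer experiments (sender $i$'s experiment is a Markov kernel from $\Omega_i$ to a message space), without commitment across rounds. The receiver observes the offers and either stops and takes an action $a\in A$ (ending the game), or consults one sender at attention cost $c>0$, observing a message from her experiment. Offers, choices and messages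 are public. The receiver's payoff is $u(a,\boldsymbol\omega)$ minus $c$ times the number of consultations; sender $i$'s payoff is the number of times she is consulted. Equilibrium is perfect Bayesian equilibrium in which the common belief $\mu^t$ about $\boldsymbol\omega$ (at the beginning of round $t$) is updated only by Bayes' rule from the messages of consulted experiments. **Values.** $U(\mu)=\max_{a\in A}\mathbb E_{\boldsymbol\omega\sim\mu}[u(a,\boldsymbol\omega)]$; $\bar v(\tilde\omega_i\mid\mu)=\mathbb E_{\omega_i\sim\mu}[U(\mu'(\mu,\omega_i))]-U(\mu)$, where $\mu'(\mu,\omega_i)$ is the posterior from $\mu$ after observing $\omega_i$ exactly; $\bar v(\tilde\omega_i\mid\boldsymbol\omega_S)=\bar v(\tilde\omega_i\mid\mu'(\boldsymbol\omega_S))$, where $\mu'(\boldsymbol\omega_S)$ is the posterior from $\mu^0$ after observing exactly $\boldsymbol\omega_S$. **Substitutes.** Senders' components are substitutes if for every $i$ and every belief $\mu$ under which the conditional distribution of $(\omega_0,\omega_i)$ given $\boldsymbol\omega_{-i}$ is the same as under $\mu^0$ (i.e. $\mu$ contains no direct information from sender $i$; the $\boldsymbol\omega_{-i}$-marginal of $\mu$ being supported in the support of that of $\mu^0$), $\bar v(\tilde\omega_i\mid\mu)\ge\mathbb E_{\boldsymbol\omega_{-i}\sim\mu}[\bar v(\tilde\omega_i\mid\boldsymbol\omega_{-i})]$. **AoN equilibrium.** An All-or-Nothing (AoN) experiment of sender $i$ with probability $\lambda$ reveals $\omega_i$ exactly with probability $\lambda$ and otherwise (independently of the state) sends a fixed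 uninformative message. An AoN equilibrium is an equilibrium in which, at belief $\mu$, each sender $i$ whose component has not been revealed offers an AoN experiment with probability $$\lambda_i^*(\mu)=\frac{c}{\mathbb E_{\boldsymbol\omega_{-i}\sim\mu}[\bar v(\tilde\omega_i\mid\boldsymbol\omega_{-i})]},$$ and the receiver visits the senders whose information has not been revealed, in some order, until all components $\omega_1,\dots,\omega_n$ are revealed. The expression $\lambda_i^*(\mu)$ is defined by this formula for every belief $\mu$ arising in the equilibrium. *)

(* Defs.v *)
From HB Require Import structures.
From mathcomp Require Import all_boot all_order all_algebra.
From mathcomp Require Import all_classical all_reals all_analysis.
From mathcomp Require Import measurable_realfun.
Import Order.TTheory GRing.Theory Num.Theory.
Import numFieldNormedType.Exports.

Set Implicit Arguments.
Unset Strict Implicit.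
Unset Printing Implicit Defensive.

Local Open Scope classical_set_scope.
Local Open Scope ring_scope.

HB.instance Definition _ (I : Type) (T : I -> ptopologicalType) :=
  Pointed.copy (prod_topology T) (forall i, T i).

HB.instance Definition _ (T U : ptopologicalType) := Pointed.on (T * U)%type.

Definition borel (T : ptopologicalType) := g_sigma_algebraType (@open T).

(* A completePseudoMetricType carries a complete compatible pseudometric; the
   Hausdorff property makes it a metric. *)
Definition polish (R : realType) (T : completePseudoMetricType R) :=
  hausdorff_space T /\ exists2 D : set T, countable D & dense D.

Section state_space.
Context (R : realType) (n : nat).
Context (T0 : completePseudoMetricType R)
        (T : 'I_n -> completePseudoMetricType R).

(* omega.1 is omega_0; omega.2 i is the component of sender i : 'I_n. *)
Definition state := borel (T0 * prod_topology T)%type.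

(* The values of omega_S, for a set S of senders. *)
Definition substate (S : {set 'I_n}) :=
  borel (prod_topology (fun k : {k : 'I_n | k \in S} => T (val k))).

Definition proj_on (S : {set 'I_n}) (w : state) : substate S :=
  fun k => w.2 (val k).
Arguments proj_on : clear implicits.

Definition only (i : 'I_n) : {set 'I_n} := finset.set1 i.
Definition others (i : 'I_n) : {set 'I_n} := finset.setC (finset.set1 i).

Definition marginal_support (S : {set 'I_n}) (mu : probability state R) :
    set (substate S) :=
  [set x | forall O : set (substate S), @open (prod_topology _) O -> O x ->
     (0 < mu (proj_on S @^-1` O))%E].
Arguments marginal_support : clear implicits.

(* [post mu S x] is the posterior from mu after observing omega_S = x exactly:
   a fixed version of the regular conditional distribution, for each belief mu
   and each set S. *)
Definition posterior_system :=
  probability state R -> forall S : {set 'I_n}, substate S ->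
  probability state R.

Definition is_posterior_system (post : posterior_system) :=
  forall (mu : probability state R) (S : {set 'I_n}),
    (forall B : set state, measurable B ->
       measurable_fun [set: substate S] (fun x : substate S => post mu S x B)) /\
    (forall (B : set state) (C : set (substate S)),
       measurable B -> measurable C ->
       (\int[mu]_(w in proj_on S @^-1` C) post mu S (proj_on S w) B
        = mu ((proj_on S @^-1` C) `&` B))%E).

Section values.
Context (Act : completePseudoMetricType R) (A : set Act)
        (u : Act -> state -> R).

Definition utility_regular :=
  {within (A `*` [set: T0 * prod_topology T]),
     continuous (fun aw : Act * (T0 * prod_topology T) => u aw.1 aw.2)} /\
  exists K : R, forall a w, A a -> `|u a w| <= K.

Definition optimal_actions_exist :=
  forall mu : probability state R, exists2 a, A a &
    forall a', A a' -> \int[mu]_w u a' w <= \int[mu]_w u a w.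

Definition decision_value (mu : probability state R) : R :=
  sup [set \int[mu]_w u a w | a in A].

Context (post : posterior_system).
Arguments post : clear implicits.

Definition info_value (i : 'I_n) (mu : probability state R) : R :=
  \int[mu]_w decision_value (post mu (only i) (proj_on (only i) w))
  - decision_value mu.

Definition info_value_given (mu0 : probability state R) (i : 'I_n)
    (S : {set 'I_n}) (x : substate S) : R :=
  info_value i (post mu0 S x).

Definition expected_last_value (mu0 : probability state R) (i : 'I_n)
    (mu : probability state R) : R :=
  \int[mu]_w info_value_given mu0 i (proj_on (others i) w).

Definition same_conditional (mu0 : probability state R) (i : 'I_n)
    (mu : probability state R) :=
  {ae mu, forall w, forall B : set (borel (T0 * T i)%type), measurable B ->
     let E := [set w' : state | B (w'.1, w'.2 i)] in
     post mu (others i) (proj_on (others i) w) E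
     = post mu0 (others i) (proj_on (others i) w) E}.

Definition substitutes (mu0 : probability state R) :=
  forall (i : 'I_n) (mu : probability state R),
    marginal_support (others i) mu `<=` marginal_support (others i) mu0 ->
    same_conditional mu0 i mu ->
    expected_last_value mu0 i mu <= info_value i mu.

Definition aon_prob (c : R) (mu0 : probability state R) (i : 'I_n)
    (mu : probability state R) : R :=
  c / expected_last_value mu0 i mu.

End values.

Section game.
Context (d : measure_display) (M : measurableType d).

Definition experiment (i : 'I_n) := R.-pker (borel (T i)) ~> M.
Definition offers := forall i, experiment i.

(* A round records the offers, the consulted sender and her message; a history
   lists the past rounds, the most recent one first. *)
Definition history := seq (offers * 'I_n * M).

Definition sender_strategy (i : 'I_n) := history -> experiment i.

Section families.
Context (d' : measure_display) (Z : measurableType d').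

Definition measurable_experiments (i : 'I_n) (e : Z -> experiment i) :=
  forall B : set M, measurable B ->
    measurable_fun [set: Z * borel (T i)] (fun zx => e zx.1 zx.2 B).

(* There is no useful sigma-algebra on the set of all experiments, hence none
   on histories; measurability of strategies is instead required along the
   families of histories that depend measurably on a parameter. *)
Inductive measurable_histories : (Z -> history) -> Prop :=
| measurable_nil : measurable_histories (fun=> [::])
| measurable_round (h : Z -> history) (e : Z -> offers) (j : 'I_n)
    (m : Z -> M) :
    measurable_histories h ->
    (forall i, measurable_experiments (fun z => e z i)) ->
    measurable_fun [set: Z] m ->
    measurable_histories (fun z => (e z, j, m z) :: h z).

End families.

Definition sender_admissible (i : 'I_n) (s : sender_strategy i) :=
  forall (d' : measure_display) (Z : measurableType d') (h : Z -> history),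
    measurable_histories h -> measurable_experiments (fun z => s (h z)).

Context (Act : completePseudoMetricType R).

(* [consult r h e j] is the probability of consulting j after history h and
   offers e; with the remaining probability the receiver stops, and her action
   is then drawn from [act r h e]. *)
Record receiver_strategy := ReceiverStrategy {
  consult : history -> offers -> 'I_n -> R ;
  act : history -> offers -> probability (borel Act) R }.

Definition stop_prob (r : receiver_strategy) (h : history) (e : offers) : R :=
  1 - \sum_(j < n) consult r h e j.

Definition receiver_admissible (A : set Act) (r : receiver_strategy) :=
  (forall h e, [/\ forall j, 0 <= consult r h e j, 0 <= stop_prob r h e
                 & act r h e A = 1%E]) /\
  (forall (d' : measure_display) (Z : measurableType d')
     (h : Z -> history) (e : Z -> offers),
     measurable_histories h ->
     (forall i, measurable_experiments (fun z => e z i)) ->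
     (forall j, measurable_fun [set: Z] (fun z => consult r (h z) (e z) j)) /\
     (forall B : set (borel Act), measurable B ->
        measurable_fun [set: Z] (fun z => act r (h z) (e z) B))).

Definition offers_at (s : forall i, sender_strategy i) (h : history) : offers :=
  fun i => s i h.

(* Expected payoff collected within the next k rounds in state w, starting after
   history h and current offers e, when stopping with action a pays g a w and
   consulting sender j pays q j. *)
Fixpoint truncated_payoff (A : set Act) (g : Act -> state -> R) (q : 'I_n -> R)
    (s : forall i, sender_strategy i) (r : receiver_strategy)
    (k : nat) (h : history) (e : offers) (w : state) : R :=
  if k is k'.+1 then
    stop_prob r h e * \int[act r h e]_(a in A) g a w
    + \sum_(j < n) consult r h e j *
        (q j + \int[e j (w.2 j)]_m
           truncated_payoff A g q s r k' ((e, j, m) :: h)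
             (offers_at s ((e, j, m) :: h)) w)
  else 0.

(* The limit is -oo for a receiver who consults forever with positive
   probability, and may be +oo for a sender. *)
Definition payoff (A : set Act) (g : Act -> state -> R) (q : 'I_n -> R)
    (s : forall i, sender_strategy i) (r : receiver_strategy)
    (mu : probability state R) (h : history) (e : offers) : \bar R :=
  limn (fun k => \int[mu]_w (truncated_payoff A g q s r k h e w)%:E)%E.

Definition receiver_payoff (A : set Act) (u : Act -> state -> R) (c : R) :=
  payoff A u (fun=> - c).

Definition sender_payoff (A : set Act) (i : 'I_n) :=
  payoff A (fun _ _ => 0) (fun j => (j == i)%:R).

(* After every history and offers, the belief following a message of the
   consulted sender is a version of the conditional distribution of the state
   given that message; it depends on nothing but the previous belief, the
   consulted experiment and the message. *)
Definition bayesian (mu0 : probability state R)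
    (b : history -> probability state R) :=
  [/\ b [::] = mu0,
      (forall h (e : offers) j,
         (forall B : set state, measurable B ->
            measurable_fun [set: M] (fun m => b ((e, j, m) :: h) B)) /\
         (forall (B : set state) (C : set M), measurable B -> measurable C ->
            (\int[b h]_w \int[e j (w.2 j)]_(m in C) b ((e, j, m) :: h) B
             = \int[b h]_(w in B) e j (w.2 j) C)%E))
    & forall h h' (e e' : offers) j m, b h = b h' -> e j = e' j ->
        b ((e, j, m) :: h) = b ((e', j, m) :: h')].

Definition equilibrium (A : set Act) (u : Act -> state -> R) (c : R)
    (mu0 : probability state R) (s : forall i, sender_strategy i)
    (r : receiver_strategy) (b : history -> probability state R) :=
  [/\ forall i, sender_admissible (s i),
      receiver_admissible A r,
      bayesian mu0 b,
      (forall h i (s' : sender_strategy i), sender_admissible s' ->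
         (sender_payoff A i (dfwith s i s') r (b h) h
            (offers_at (dfwith s i s') h)
          <= sender_payoff A i s r (b h) h (offers_at s h))%E)
    & (forall h e (r' : receiver_strategy), receiver_admissible A r' ->
         (receiver_payoff A u c s r' (b h) h e
          <= receiver_payoff A u c s r (b h) h e)%E)].

(* The experiment e shows the message rev x, from which x can be decoded, with
   probability l, and the uninformative message m0 otherwise. *)
Definition aon_experiment (i : 'I_n) (l : R) (rev : borel (T i) -> M) (m0 : M)
    (e : experiment i) :=
  [/\ 0 <= l <= 1,
      measurable_fun [set: borel (T i)] rev /\ measurable (range rev),
      (exists2 dec : M -> borel (T i), measurable_fun [set: M] dec &
         cancel rev dec),
      ~ range rev m0
    & forall x (B : set M), measurable B ->
        (e x B = l%:E * \d_(rev x) B + (1 - l)%:E * \d_m0 B)%E].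

Definition is_aon (i : 'I_n) (l : R) (e : experiment i) :=
  exists rev m0, aon_experiment l rev m0 e.

Fixpoint revealed (i : 'I_n) (h : history) : Prop :=
  if h is (e, j, m) :: h' then
    (j = i /\ exists l rev m0, aon_experiment l rev m0 (e i) /\ range rev m)
    \/ revealed i h'
  else False.

(* Q holds almost surely for the public history k rounds after h, if these k
   rounds follow the strategies s and r. *)
Fixpoint almost_surely_after (s : forall i, sender_strategy i)
    (r : receiver_strategy) (b : history -> probability state R)
    (Q : history -> Prop) (k : nat) (h : history) : Prop :=
  if k is k'.+1 then
    forall j, 0 < consult r h (offers_at s h) j ->
      {ae b h, forall w, {ae s j h (w.2 j), forall m,
         almost_surely_after s r b Q k' ((offers_at s h, j, m) :: h)}}
  else Q h.

(* Conditional expectation, given the public history h at the beginning of a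
   round, of a function f of the public history at the beginning of the next
   round (the game goes on, i.e. the receiver does not stop in this round). *)
Definition expect_next (s : forall i, sender_strategy i)
    (r : receiver_strategy) (b : history -> probability state R)
    (f : history -> R) (h : history) : \bar R :=
  (\sum_(j < n) (consult r h (offers_at s h) j)%:E *
     \int[b h]_w \int[s j h (w.2 j)]_m (f ((offers_at s h, j, m) :: h))%:E)%E.

Definition aon_equilibrium (post : posterior_system) (A : set Act)
    (u : Act -> state -> R) (c : R) (mu0 : probability state R)
    (s : forall i, sender_strategy i) (r : receiver_strategy)
    (b : history -> probability state R) :=
  equilibrium A u c mu0 s r b /\
  forall t, almost_surely_after s r b (fun h =>
    [/\ forall i, ~ revealed i h ->
          is_aon (aon_prob A u post c mu0 i (b h)) (s i h),
        forall i, revealed i h -> consult r h (offers_at s h) i = 0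
      & (exists i, ~ revealed i h) -> stop_prob r h (offers_at s h) = 0])
    t [::].

End game.
End state_space.

Arguments proj_on {R n T0 T} S w.
Arguments marginal_support {R n T0 T} S mu.

(* Main.v *)
(** The denominator of lambda_i^* at a belief nu is the integral under nu of one
    fixed function f of omega_{-i}, so along Bayes-consistent beliefs it is a
    martingale, and Jensen's inequality for y |-> c / y gives the claim. Two
    points need work. First, f > c only on the support of mu0, and this
    bound has to survive updating: the support has full measure (Polish spaces
    are second countable), and a set that is null for a belief is almost surely
    null for the next one. Second, f must be replaced by a measurable function:
    for almost every x, the posterior of mu0(. | omega_{-i} = x) after omega_i
    agrees with the posterior of mu0 after all of omega_1, ..., omega_n, which
    depends measurably on the observation, and the decision value is a supremum
    of countably many expected utilities because actions are separable. *)

Require Import Defs.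
From HB Require Import structures.
From mathcomp Require Import all_boot all_order all_algebra.
From mathcomp Require Import all_classical all_reals all_analysis.
From mathcomp Require Import measurable_realfun ring lra.
Import Order.TTheory GRing.Theory Num.Theory.
Import numFieldNormedType.Exports.

Local Open Scope classical_set_scope.
Local Open Scope ring_scope.

Set Implicit Arguments.
Unset Strict Implicit.
Unset Printing Implicit Defensive.

(** * Mixtures, densities and almost-everywhere equality *)

Section mixtures.
Context {d d' : measure_display} {X : measurableType d} {Z : measurableType d'}.
Context {R : realType}.
Local Open Scope ereal_scope.
Import HBNNSimple.

(** Hypothesis [kE] is the claim for indicators; linearity extends it to simple functions and
    monotone convergence to [f]. Mixtures, posteriors after an exact observation and Bayesian
    updates are all instances. *)
Lemma ge0_integral_disintegration (m : {measure set X -> \bar R})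
    (k : X -> {measure set Z -> \bar R}) (mu : {measure set Z -> \bar R})
    (D : set X) (E : set Z) (mD : measurable D) (mE : measurable E)
    (mk : forall B, measurable B -> measurable_fun [set: X] (k ^~ B))
    (kE : forall B, measurable B -> \int[m]_(x in D) k x B = mu (E `&` B))
    (f : Z -> \bar R) (f0 : forall z, 0 <= f z)
    (mf : measurable_fun [set: Z] f) :
  \int[m]_(x in D) \int[k x]_z f z = \int[mu]_(z in E) f z.
Proof.
pose g := nnsfun_approx measurableT mf.
have gf z : limn (fun n => (g n z)%:E) = f z.
  by apply/cvg_lim => //; exact: cvg_nnsfun_approx.
have mg n : measurable_fun [set: Z] (EFin \o g n) by exact/measurable_EFinP.
have ndg z : {homo (fun n => (g n z)%:E) : a b / (a <= b)%N >-> a <= b}.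
  by move=> a b ab; rewrite lee_fin; exact/lefP/nd_nnsfun_approx.
have limE (nu : {measure set Z -> \bar R}) (B : set Z) : measurable B ->
    \int[nu]_(z in B) f z = limn (fun n => \int[nu]_(z in B) (g n z)%:E).
  move=> mB; rewrite -monotone_convergence//.
  - by apply: eq_integral => z _; rewrite gf.
  - by move=> n; exact: measurable_funS (mg n).
  - by move=> n z _; rewrite lee_fin.
under eq_integral do rewrite limE//.
rewrite limE// monotone_convergence//; last 3 first.
- move=> n; apply: (@measurable_funS _ _ _ _ setT) => //.
  apply: measurable_fun_integral_kernel => //; last exact: mg.
  by move=> z; rewrite lee_fin.
- by move=> n x _; apply: integral_ge0 => z _; rewrite lee_fin.
- move=> x _ a b ab; apply: ge0_le_integral => //.
  + by move=> z _; rewrite lee_fin.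
  + exact: mg.
  + exact: mg.
  + by move=> z _; exact: ndg.
congr (limn _); apply/funext => n.
have sumE (nu : {measure set Z -> \bar R}) (B : set Z) : measurable B ->
    \int[nu]_(z in B) (g n z)%:E =
    \sum_(r \in range (g n)) r%:E * nu (B `&` (g n @^-1` [set r])).
  move=> mB; under eq_integral do rewrite fimfunE -fsumEFin//.
  rewrite ge0_integral_fsum//; last 2 first.
  - by move=> r; exact/measurable_EFinP/measurableT_comp.
  - by move=> r z _; rewrite EFinM nnfun_muleindic_ge0.
  apply: eq_fsbigr => r _.
  by rewrite integralZl_indic_nnsfun// integral_indic// setIC.
have mkr r : measurable_fun D (fun x => k x (g n @^-1` [set r])).
  by apply: (@measurable_funS _ _ _ _ setT) => //; exact: mk.
under eq_integral do rewrite sumE//.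
rewrite sumE// ge0_integral_fsum//; last 2 first.
- move=> r; apply: measurable_funeM.
  by under eq_fun do rewrite setTI; exact: mkr.
(* Nonnegativity is demanded at every real [r]; for [r < 0] the level set of [g n] is empty. *)
- move=> r x _; have [r0|r0] := leP 0%R r; first by rewrite mule_ge0.
  by rewrite preimage_nnfun0// setI0 measure0 mule0.
apply: eq_fsbigr => r _.
under eq_integral do rewrite setTI.
have [r0|r0] := leP 0%R r; first by rewrite ge0_integralZl// kE.
rewrite preimage_nnfun0// setI0 measure0 mule0.
by rewrite integral0_eq// => x _; rewrite measure0 mule0.
Qed.

Section mixture.
Variables (m : {measure set X -> \bar R}) (k : X -> {measure set Z -> \bar R}).
Hypothesis mk : forall B, measurable B -> measurable_fun [set: X] (k ^~ B).

(* The proof argument lets the measure instance be found by unification. *)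
Definition mixture of (forall B, measurable B ->
    measurable_fun [set: X] (k ^~ B)) :=
  fun B : set Z => \int[m]_x k x B.

Let mixture0 : mixture mk set0 = 0.
Proof. by rewrite /mixture integral0_eq. Qed.

Let mixture_ge0 B : 0 <= mixture mk B.
Proof. exact: integral_ge0. Qed.

Let mixture_sigma_additive : semi_sigma_additive (mixture mk).
Proof.
move=> F mF tF mUF; rewrite /mixture.
rewrite [X in _ --> X](_ : _ = \int[m]_x \sum_(n <oo) k x (F n)); last first.
  by apply: eq_integral => x _; rewrite measure_semi_bigcup.
rewrite integral_nneseries//; last by move=> n; exact: mk.
by apply: is_cvg_nneseries => n _ _; exact: integral_ge0.
Qed.

HB.instance Definition _ := isMeasure.Build _ _ _ (mixture mk)
  mixture0 mixture_ge0 mixture_sigma_additive.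

Lemma ge0_integral_mixture (f : Z -> \bar R) :
  (forall z, 0 <= f z) -> measurable_fun [set: Z] f ->
  \int[mixture mk]_z f z = \int[m]_x \int[k x]_z f z.
Proof.
move=> f0 mf; apply/esym/ge0_integral_disintegration => // B mB.
by rewrite setTI.
Qed.

End mixture.
End mixtures.

Section density.
Context {d : measure_display} {X : measurableType d} {R : realType}.
Local Open Scope ereal_scope.
Variables (m : {measure set X -> \bar R}) (f : X -> \bar R).
Hypotheses (mf : measurable_fun [set: X] f) (f0 : forall x, 0 <= f x).

(** Turns equality of integrals into equality of measures, so that uniqueness on a pi-system
    applies. The proofs are arguments so that unification finds the measure instance. *)
Definition density of measurable_fun [set: X] f & (forall x, 0 <= f x) :=
  fun A : set X => \int[m]_(x in A) f x.

Let density0 : density mf f0 set0 = 0.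
Proof. exact: integral_set0. Qed.

Let density_ge0 A : 0 <= density mf f0 A.
Proof. exact: integral_ge0. Qed.

Let density_sigma_additive : semi_sigma_additive (density mf f0).
Proof.
move=> F mF tF mUF; rewrite /density ge0_integral_bigcup//.
  by apply: is_cvg_nneseries => n _ _; exact: integral_ge0.
exact: measurable_funS mf.
Qed.

HB.instance Definition _ := isMeasure.Build _ _ _ (density mf f0)
  density0 density_ge0 density_sigma_additive.

End density.

(** [g1] and [g2] are densities with respect to the image of [nu] under [p]. The measures they
    define agree on the generating pi-system [G], hence everywhere, and a density with finite
    integral is unique almost everywhere; the null set is then pulled back along [p]. *)
Lemma ae_eq_pi_system {d d' : measure_display} {Z : measurableType d}
    {Y : measurableType d'} {R : realType} (nu : {measure set Z -> \bar R})
    (p : Z -> Y) (mp : measurable_fun [set: Z] p) (G : set (set Y))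
    (GT : G [set: Y]) (GI : setI_closed G) (mG : measurable = <<s G>>)
    (g1 g2 : Y -> \bar R) (g10 : forall y, (0 <= g1 y)%E)
    (g20 : forall y, (0 <= g2 y)%E) (mg1 : measurable_fun [set: Y] g1)
    (mg2 : measurable_fun [set: Y] g2)
    (fin : (\int[nu]_z g1 (p z) < +oo)%E)
    (g12 : forall C, G C ->
      (\int[nu]_(z in p @^-1` C) g1 (p z) =
       \int[nu]_(z in p @^-1` C) g2 (p z))%E) :
  {ae nu, forall z, g1 (p z) = g2 (p z)}.
Proof.
have pushE (g : Y -> \bar R) C : (forall y, (0 <= g y)%E) ->
    measurable_fun setT g -> measurable C ->
    (\int[pushforward nu p]_(y in C) g y = \int[nu]_(z in p @^-1` C) g (p z))%E.
  move=> g0 mg mC; rewrite ge0_integral_pushforward//.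
  exact: measurable_funS mg.
pose pnu_ : {measure set Y -> \bar R} := pushforward nu p.
pose pnu := pnu_ mp.
have GM : G `<=` measurable by rewrite mG; exact: sub_gen_smallest.
have : ae_eq pnu setT g1 g2.
  apply: integral_ae_eq => //.
    apply/integrableP; split => //.
    under eq_integral do rewrite gee0_abs//.
    by rewrite pushE// preimage_setT.
  move=> E _; rewrite mG => GE.
  (* Since [G] contains the whole space, which has finite mass by [fin], the constant sequence
     serves as exhaustion. *)
  apply: (@g_sigma_algebra_measure_unique _ _ _ G GM (fun=> setT) _ _
    (density pnu mg1 g10) (density pnu mg2 g20)) => //.
  - by rewrite bigcup_const//; exists 0%N.
  - move=> A GA; have mA := GM A GA.
    by rewrite /= /density !pushE//; exact: g12.
  - by move=> _; rewrite /= /density pushE// preimage_setT.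
move=> [N [mN N0 subN]]; exists (p @^-1` N); split => //.
- by rewrite -[X in measurable X]setTI; apply: (mp).
- by move=> z /= gz; apply: subN => /= /(_ I).
Qed.

Lemma integral_cst_probability {d : measure_display} {X : measurableType d}
    {R : realType} (P : probability X R) (k : \bar R) :
  (\int[P]_x k = k)%E.
Proof. by rewrite integral_cst//= probability_setT mule1. Qed.

(** * Integrals of bounded functions under a probability *)

Section bounded_integrals.
Context {d : measure_display} {Z : measurableType d} {R : realType}.
Variables (f : Z -> R) (K : R).
Hypotheses (mf : measurable_fun [set: Z] f) (fK : forall z, `|f z| <= K).

Lemma bounded_integrable (P : probability Z R) :
  P.-integrable [set: Z] (EFin \o f).
Proof.
apply: measurable_bounded_integrable => //.
  by rewrite -ge0_fin_numE// fin_num_measure.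
exists K; split; first exact: num_real.
by move=> x Kx z _; exact: le_trans (fK z) (ltW Kx).
Qed.

(** Adding the bound [K] gives access to the theory of nonnegative integrals; under a probability
    the shift comes out of the integral as [K] itself. *)
Lemma shifted_ge0 z : (0 <= (f z + K)%:E)%E.
Proof. by rewrite lee_fin -lerBlDr sub0r; have /ler_normlP[] := fK z; lra. Qed.

Lemma integral_shifted (P : probability Z R) :
  (\int[P]_z (f z + K)%:E = (\int[P]_z f z + K)%:E)%E.
Proof.
under eq_integral do rewrite EFinD.
rewrite integralD//=; last exact: finite_measure_integrable_cst.
  rewrite integral_cst_probability EFinD; congr (_ + _)%E.
  by rewrite /Rintegral fineK//; exact/integrable_fin_num/bounded_integrable.
exact: bounded_integrable.
Qed.

Lemma measurable_shifted : measurable_fun [set: Z] (fun z => (f z + K)%:E).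
Proof. by apply/measurable_EFinP; exact: measurable_funD. Qed.

Lemma le_norm_Rintegral_bound (P : probability Z R) : `|\int[P]_z f z| <= K.
Proof.
have iP := bounded_integrable P.
apply: le_trans (le_normr_Rintegral measurableT iP) _.
rewrite -lee_fin /Rintegral fineK; last first.
  by apply: integrable_fin_num => //; exact: integrable_norm.
apply: (@le_trans _ _ (\int[P]_z K%:E)%E).
  apply: ge0_le_integral => //.
    by apply/measurable_EFinP; apply: measurableT_comp.
  by move=> z _; rewrite lee_fin.
by rewrite integral_cst_probability.
Qed.

Lemma measurable_Rintegral_kernel {d' : measure_display} {X : measurableType d'}
    (k : X -> probability Z R) :
  (forall B, measurable B -> measurable_fun [set: X] (fun x => k x B)) ->
  measurable_fun [set: X] (fun x => \int[k x]_z f z).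
Proof.
move=> mk; rewrite (_ : (fun x => _) =
    (fun x => fine (\int[k x]_z (f z + K)%:E)%E - K)); last first.
  by apply/funext => x; rewrite integral_shifted//= addrK.
apply: measurable_funB => //; apply: measurableT_comp => //.
apply: measurable_fun_integral_kernel => //; first exact: shifted_ge0.
exact: measurable_shifted.
Qed.

End bounded_integrals.

(** * Countable bases *)

Section countable_base.
Context {T : topologicalType}.

Definition base_sequence (O : nat -> set T) :=
  (forall k, open (O k)) /\
  forall (x : T) (U : set T), open U -> U x -> exists2 k, O k x & O k `<=` U.

(** With [g] injective from [B] to the naturals, the union of the members of [B] coded by [k] is a
    single member or empty, which gives a total enumeration. *)
Lemma countable_base_sequence (B : set (set T)) : countable B -> B `<=` open ->
  (forall (x : T) (U : set T), open U -> U x ->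
    exists2 V, B V & V x /\ V `<=` U) ->
  exists O, base_sequence O.
Proof.
move=> /countable_injP[g injg] Bo Bb.
exists (fun k => \bigcup_(V in [set V | B V /\ g V = k]) V); split.
  by move=> k; apply: bigcup_open => V [/Bo].
move=> x U oU Ux; have [V BV [Vx VU]] := Bb x U oU Ux.
exists (g V); first by exists V.
by move=> y [W [BW gW] Wy]; rewrite -(injg _ _ _ _ gW) ?inE// in VU; exact: VU.
Qed.

Lemma base_sequence_point (O : nat -> set T) (x y : T) : base_sequence O ->
  accessible_space T -> (forall k, O k x -> O k y) -> y = x.
Proof.
move=> [_ bO] T1 xy; apply/eqP/negPn/negP => yx.
have [|U [oU]] := T1 x y; first by rewrite eq_sym.
rewrite !inE => Ux Uy.
have [k Okx OkU] := bO x U oU Ux.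
by move/xy: Okx => /OkU.
Qed.

Lemma base_sequence_bigcup (O : nat -> set T) (U : set T) : base_sequence O ->
  open U -> U = \bigcup_(k in [set k | O k `<=` U]) O k.
Proof.
move=> [_ bO] oU; apply/seteqP; split=> [x Ux|x [k /= OkU]]; last exact: OkU.
by have [k Okx OkU] := bO x U oU Ux; exists k.
Qed.

(** Indexing by lists keeps the family countable, makes concatenation the intersection, and gives
    the whole space for the empty list. *)
Definition finI_sequence (O : nat -> set T) (l : seq nat) : set T :=
  [set x | forall k, k \in l -> O k x].

Lemma finI_sequence_pi (O : nat -> set T) :
  setI_closed (range (finI_sequence O)).
Proof.
move=> _ _ [l1 _ <-] [l2 _ <-]; exists (l1 ++ l2) => //.
apply/seteqP; split=> [x Ox|x [xl1 xl2] k].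
  by split=> k kl; apply: Ox; rewrite mem_cat kl ?orbT.
by rewrite mem_cat => /orP[/xl1|/xl2].
Qed.

Lemma finI_sequence_open (O : nat -> set T) l : base_sequence O ->
  open (finI_sequence O l).
Proof.
move=> [oO _]; elim: l => [|k l IH].
  rewrite (_ : finI_sequence _ _ = setT); first exact: openT.
  by apply/seteqP; split.
rewrite (_ : finI_sequence _ _ = O k `&` finI_sequence O l); first exact: openI.
apply/seteqP; split=> [x Ox|x [Okx Ox] j].
  by split=> [|j jl]; apply: Ox; rewrite inE ?eqxx// jl orbT.
by rewrite inE => /orP[/eqP ->|/Ox].
Qed.

End countable_base.

(** Every open set is a countable union of base sets, so a countable pi-system generates the Borel
    sets; this is what lets null sets be merged later. *)
Lemma borel_finI_sequence {T : ptopologicalType} (O : nat -> set T) :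
  base_sequence O ->
  (measurable : set (set (borel T))) = <<s range (finI_sequence O) >>.
Proof.
move=> bO; apply/seteqP; split.
- apply: smallest_sub; first exact: smallest_sigma_algebra.
  move=> U oU; rewrite (base_sequence_bigcup bO oU) bigcup_mkcond.
  apply: (@bigcupT_measurable _
    (g_sigma_algebraType (range (finI_sequence O)))) => k.
  case: ifPn => _; last exact: (@measurable0 _ (g_sigma_algebraType _)).
  apply: sub_gen_smallest; exists [:: k] => //.
  apply/seteqP; split=> [x /(_ k)|x Okx j]; first by rewrite inE; exact.
  by rewrite inE => /eqP ->.
- apply: smallest_sub; first exact: smallest_sigma_algebra.
  by move=> _ [l _ <-]; apply: sub_gen_smallest; exact: finI_sequence_open.
Qed.

Lemma polish_base {R : realType} (T : completePseudoMetricType R) :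
  polish T -> exists O : nat -> set T, base_sequence O.
Proof.
move=> [_ [D cD dD]].
(* Centres range over the dense set and radii over [1/(n+1)]. A ball of a pseudometric need not be
   open here, hence the interior. *)
pose f (xn : T * nat) : set T := (ball xn.1 (xn.2.+1%:R^-1 : R))°.
apply: (@countable_base_sequence _ (f @` (D `*` [set: nat]))).
- apply: sub_countable (card_image_le _ _) _; exact: countableX.
- by move=> _ [[x n] _ <-]; exact: open_interior.
move=> x U oU Ux.
have /nbhs_ballP[e /= e0 xeU] : nbhs x U by exact: open_nbhs_nbhs.
(* With [1/(n+1)] below [e/2] and a centre [y] within half that radius of [x], the ball about [y]
   contains a ball about [x] and stays within [e] of [x]. *)
have [n] := ltr_add_invr (divr_gt0 e0 (ltr0Sn R 1)); rewrite add0r => ne.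
have n0 : (0 : R) < n.+1%:R^-1 / 2 by rewrite divr_gt0// invr_gt0.
have [y [/interior_subset xy Dy]] :
    (ball x (n.+1%:R^-1 / 2 : R))° `&` D !=set0.
  by apply: dD; [exists x; exact: nbhsx_ballx|exact: open_interior].
exists (f (y, n)); first by exists (y, n).
split=> [|z /interior_subset/= yz].
  apply/nbhs_ballP; exists (n.+1%:R^-1 / 2) => //= z xz.
  by rewrite [n.+1%:R^-1]splitr; apply: ball_triangle xz; exact: ball_sym.
apply: xeU; rewrite [e]splitr; apply: ball_triangle (le_ball (ltW ne) yz).
apply: le_ball xy; apply: le_trans (ltW ne).
by rewrite ler_pdivrMr// ler_peMr// ?ler1n// invr_ge0.
Qed.

(** As [J] is finite, the boxes with one base set in each coordinate are open and countably many. *)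
Lemma prod_topology_base {J : finType} (T : J -> topologicalType) :
  (forall i, exists O : nat -> set (T i), base_sequence O) ->
  exists O : nat -> set (prod_topology T), base_sequence O.
Proof.
move=> /(_ _)/cid-/all_sig[B bB].
pose box (c : {ffun J -> nat}) : set (prod_topology T) :=
  \bigcap_(i in [set: J]) (proj i @^-1` B i (c i)).
have obox c : open (box c).
  rewrite openE => x xc; rewrite /interior.
  rewrite (_ : box c = [set y | forall i, B i (c i) (proj i y)]); last first.
    by apply/seteqP; split=> [y yc i|y yc i _]; exact: yc.
  apply: (@filter_forall _ J (fun i y => B i (c i) (proj i y)) (nbhs x)) => i.
  apply: (@proj_continuous _ T i x).
  by apply: open_nbhs_nbhs; split; [exact: (bB i).1|exact: xc].
apply: (@countable_base_sequence _ (range box)).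
- exact: sub_countable (card_image_le _ _) (countableP _).
- by move=> _ [c _ <-].
move=> x U oU Ux.
(* The boxes around [x] generate a filter. Its convergence to [x], which can be checked coordinate
   by coordinate, puts a box inside [U]. *)
pose F : set_system (prod_topology T) :=
  filter_from [set c | box c x] box.
have FF : Filter F.
  apply: filter_from_filter.
    have /choice[c Oc] i : exists k, B i k (x i).
      have [k Okx _] := (bB i).2 (x i) setT openT I.
      by exists k.
    by exists (finfun c) => i _; rewrite /= /proj ffunE.
  move=> c1 c2 xc1 xc2.
  have /choice[c Oc] i : exists k, B i k (x i) /\
      B i k `<=` B i (c1 i) `&` B i (c2 i).
    have [| |k Okx kc] := (bB i).2 (x i) (B i (c1 i) `&` B i (c2 i)).
    - by apply: openI; exact: (bB i).1.
    - by split; [exact: xc1|exact: xc2].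
    - by exists k.
  exists (finfun c) => [i _|y yc].
    by rewrite /= /proj ffunE; have [] := Oc i.
  by split=> i _; have := yc i I; rewrite /= /proj ffunE => /(Oc i).2[].
suff /(_ U) : F --> x.
  by case=> [|c xc cU]; [exact: open_nbhs_nbhs|exists (box c)].
apply/cvg_sup => i V.
rewrite (@nbhsE (initial_topology _)) => -[W [[W' oW' <-] Wx] WV].
have [k Okx kW'] := (bB i).2 (x i) W' oW' Wx.
(* The premise [j = i] states the condition on coordinate [i] uniformly in [j], without transport
   between [T j] and [T i]. *)
have /choice[c Oc] j : exists l,
    B j l (x j) /\ forall y : prod_topology T, B j l (y j) -> j = i -> W' (y i).
  have [->|ji] := eqVneq j i; first by exists k; split=> // y /kW'.
  have [l Olx _] := (bB j).2 (x j) setT openT I.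
  by exists l; split=> // y _ /eqP; rewrite (negbTE ji).
apply: filterS (WV) _; exists (finfun c) => [j _|y yc].
  by rewrite /= /proj ffunE; have [] := Oc j.
by have := yc i I; rewrite /= /proj ffunE => /(Oc i).2; apply.
Qed.

(** * Observations, decision values and posteriors *)

Lemma borel_continuous_measurable {S S' : ptopologicalType} (f : S -> S') :
  continuous f -> measurable_fun [set: borel S] (f : borel S -> borel S').
Proof.
move=> /continuousP cf.
apply: (@measurability _ _ (borel S) (borel S') setT f (@open S')) => //.
move=> _ [U oU <-]; rewrite setTI.
by apply: sub_gen_smallest; exact: cf.
Qed.

Lemma borel_continuous_measurable_real {R : realType} {S : ptopologicalType}
    (f : S -> R) :
  continuous f -> measurable_fun [set: borel S] f.
Proof.
move=> /continuousP cf.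
apply: (measurability _ (RGenOpens.measurableE R)) => //.
move=> _ [_ [a [b ->] <-]]; rewrite setTI.
by apply: sub_gen_smallest; apply: cf; exact: interval_open.
Qed.

Lemma continuous_prod_topology {S : topologicalType} {I : Type}
    {T : I -> topologicalType} (f : S -> prod_topology T) :
  (forall i, continuous (fun z => f z i)) -> continuous f.
Proof.
move=> cf z; apply/cvg_sup => i V.
rewrite (@nbhsE (initial_topology _)) => -[W [[W' oW' <-] Wx] WV].
apply: filterS (WV) _; apply: (cf i z).
by apply: open_nbhs_nbhs.
Qed.

(** * Observed components and their marginal support *)

Section state_space.
Context {R : realType} {n : nat} {T0 : completePseudoMetricType R}.
Context {T : 'I_n -> completePseudoMetricType R}.
Hypothesis hT : forall i, polish (T i).

Lemma proj_on_continuous (S : {set 'I_n}) :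
  continuous (proj_on S : T0 * prod_topology T ->
    prod_topology (fun k : {k : 'I_n | k \in S} => T (val k))).
Proof.
apply: continuous_prod_topology => k w.
apply: (@cvg_comp _ _ _ snd (proj (val k))); first exact: cvg_snd.
exact: (@proj_continuous _ T (val k) w.2).
Qed.

Lemma measurable_proj_on (S : {set 'I_n}) :
  measurable_fun [set: state T0 T] (proj_on S : state T0 T -> substate T S).
Proof. exact: (@borel_continuous_measurable (T0 * prod_topology T)%type
  (prod_topology (fun k : {k : 'I_n | k \in S} => T (val k))) _
  (@proj_on_continuous S)). Qed.

Lemma substate_base (S : {set 'I_n}) : exists O : nat ->
    set (prod_topology (fun k : {k : 'I_n | k \in S} => T (val k))),
  base_sequence O.
Proof. by apply: prod_topology_base => k; exact: polish_base. Qed.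

Lemma substate_accessible (S : {set 'I_n}) :
  accessible_space (prod_topology (fun k : {k : 'I_n | k \in S} => T (val k))).
Proof.
apply: hausdorff_accessible; apply: hausdorff_product => k.
by have [] := hT (val k).
Qed.

(** A point outside the support has an open neighbourhood of probability zero, hence lies in a null
    base set, and there are only countably many of these. *)
Lemma ae_marginal_support (S : {set 'I_n}) (mu : probability (state T0 T) R) :
  {ae mu, forall w, marginal_support S mu (proj_on S w)}.
Proof.
have [B bB] := substate_base S.
have : {ae mu, forall w, forall k, mu (proj_on S @^-1` B k) = 0%E ->
    ~ B k (proj_on S w)}.
  apply: ae_foralln => k.
  have [Bk0|Bk0] := pselect (mu (proj_on S @^-1` B k) = 0%E); last exact: aeW.
  exists (proj_on S @^-1` B k); split => //.
    rewrite -[X in measurable X]setTI; apply: measurable_proj_on => //.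
    by apply: sub_gen_smallest; exact: bB.1.
  by move=> w /= /not_implyP[_]; exact: contrapT.
apply: filterS => w wB U oU Uw.
have [k Bkw BkU] := bB.2 _ U oU Uw.
rewrite lt0e measure_ge0 andbT; apply/eqP => U0.
apply: (wB k) => //; apply/eqP; rewrite -measure_le0 -U0.
have mO V : open V -> measurable (proj_on S @^-1` V : set (state T0 T)).
  move=> oV; rewrite -[X in measurable X]setTI; apply: measurable_proj_on => //.
  exact: sub_gen_smallest.
apply: le_measure; rewrite ?inE; [by apply: mO; exact: bB.1|exact: mO|].
by move=> v; exact: BkU.
Qed.

End state_space.

(** * Decision values as countable suprema *)

Section decision_values.
Context {R : realType} {n : nat} {T0 : completePseudoMetricType R}.
Context {T : 'I_n -> completePseudoMetricType R}.
Context {Act : completePseudoMetricType R} {A : set Act}.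
Context {u : Act -> state T0 T -> R}.
Hypothesis hu : utility_regular A u.

(** Continuity of [u] holds only relative to [A], so the actions must stay in [A] along the filter.
    This covers both continuity in the state and limits of actions. *)
Lemma utility_cvg {S : Type} (F : set_system S) {FF : Filter F}
    (f : S -> Act) (g : S -> T0 * prod_topology T) (a : Act)
    (w : T0 * prod_topology T) :
  A a -> (forall s, A (f s)) -> f @ F --> a -> g @ F --> w ->
  (fun s => u (f s) (g s)) @ F --> u a w.
Proof.
move=> Aa Af fa gw V Vu; have [/subspace_continuousP/(_ (a, w))cu _] := hu.
have /cu/(_ V Vu) nV : (A `*` [set: T0 * prod_topology T]) (a, w) by [].
have [[P Q] [/= Pa Qw] PQ] := nV.
apply: (@filterS2 _ F _ _ _ _ _ (fa P Pa) (gw Q Qw)) => s /= Ps Qs.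
exact: (PQ (f s, g s) (conj Ps Qs) (conj (Af s) I)).
Qed.

Lemma measurable_utility (a : Act) : A a ->
  measurable_fun [set: state T0 T] (u a).
Proof.
move=> Aa; apply: (@borel_continuous_measurable_real _
  (T0 * prod_topology T)%type) => w.
apply: (@utility_cvg _ (nbhs w) (nbhs_filter w) (fun=> a) id) => //.
exact: (@cvg_cst Act).
Qed.

Lemma measurable_expected_utility {d : measure_display} {X : measurableType d}
    (k : X -> probability (state T0 T) R) (a : Act) : A a ->
  (forall B, measurable B -> measurable_fun [set: X] (fun x => k x B)) ->
  measurable_fun [set: X] (fun x => \int[k x]_w u a w).
Proof.
move=> Aa; have [_ [K uK]] := hu.
apply: (@measurable_Rintegral_kernel _ _ _ _ K).
  exact: measurable_utility.
by move=> w; exact: uK.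
Qed.

Lemma expected_utility_le (nu : probability (state T0 T) R) (K : R) (a : Act) :
  A a -> (forall w, `|u a w| <= K) -> `|\int[nu]_w u a w| <= K.
Proof.
move=> Aa uK; apply: le_norm_Rintegral_bound => //.
exact: measurable_utility.
Qed.

Section separability.
Hypotheses (hAct : polish Act) (A0 : A !=set0).

(** A sequence of actions dense in [A] suffices: expected utility at any action is, by dominated
    convergence with bound [K], a limit of expected utilities along the sequence. *)
Lemma utility_sequence : exists a : nat -> Act, (forall k, A (a k)) /\
  forall nu : probability (state T0 T) R,
    decision_value A u nu = sup (range (fun k => \int[nu]_w u (a k) w)).
Proof.
have [B bB] := polish_base hAct; have [a0 Aa0] := A0.
(* Picks an action of [A] in each base set that meets [A], and [a0] for the others. *)
have /choice[a Ba] k : exists a, A a /\ (B k `&` A !=set0 -> B k a).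
  have [[x [Bx Ax]]|nB] := pselect (B k `&` A !=set0); first by exists x.
  by exists a0; split.
have Aa k : A (a k) by have [] := Ba k.
exists a; split=> // nu; have [_ [K uK]] := hu.
have Vub : has_ubound [set \int[nu]_w u a w | a in A].
  exists K => _ [b Ab <-].
  have := @expected_utility_le nu K b Ab (fun w => uK b w Ab).
  by rewrite ler_norml => /andP[].
apply/eqP; rewrite eq_le; apply/andP; split; last first.
  apply: ge_sup; first by exists (\int[nu]_w u (a 0%N) w), 0%N.
  by move=> _ [k _ <-]; apply: ub_le_sup => //; exists (a k).
have Vub' : has_ubound (range (fun k => \int[nu]_w u (a k) w)).
  case: Vub => y yub; exists y => _ [k _ <-]; apply: yub; exists (a k) => //.
apply: ge_sup; first by exists (\int[nu]_w u a0 w), a0.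
move=> _ [b Ab <-].
have /choice[f fb] (m : nat) : exists k, ball b m.+1%:R^-1 (a k).
  have m0 : (0 : R) < m.+1%:R^-1 by rewrite invr_gt0.
  have [||k Bkb kb] := bB.2 b ((ball b (m.+1%:R^-1 : R))°).
  - exact: open_interior.
  - exact: nbhsx_ballx.
  have Bka : B k (a k) by apply: (proj2 (Ba k)); exists b.
  by exists k; have := kb _ Bka; exact: interior_subset.
have ab : a \o f @ \oo --> b.
  apply/cvg_ballP => e e0; have [m _ me] := near_infty_natSinv_lt (PosNum e0).
  by exists m => // j /= mj; apply: le_ball (fb j); exact/ltW/me.
have cV : (fun m => \int[nu]_w u (a (f m)) w) @ \oo --> \int[nu]_w u b w.
  have [|||||_ _] := @dominated_convergence _ _ _ nu setT measurableT
     (fun m w => (u (a (f m)) w)%:E) (fun w => (u b w)%:E) (cst K%:E).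
  - by move=> m; apply/measurable_EFinP; exact: measurable_utility.
  - by apply/measurable_EFinP; exact: measurable_utility.
  - apply: aeW => w _; apply/fine_cvgP; split; first exact: nearW.
    apply: (@utility_cvg _ \oo _ (a \o f) (fun=> w) b w Ab _ ab).
      by move=> m; exact: Aa.
    exact: cvg_cst.
  - exact: finite_measure_integrable_cst.
  - by apply: aeW => w m _; rewrite /= lee_fin uK.
  have -> : (\int[nu]_w (u b w)%:E)%E = (\int[nu]_w u b w)%:E.
    rewrite /Rintegral fineK//; apply/integrable_fin_num => //.
    apply: (@bounded_integrable _ _ _ _ K); first exact: measurable_utility.
    by move=> w; exact: uK.
  by move=> /fine_cvg.
rewrite -(cvg_lim _ cV)//; apply: limr_le; first exact: cvgP cV.
by apply: nearW => m; apply: ub_le_sup => //; exists (f m).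
Qed.

Lemma measurable_decision_value {d : measure_display} {X : measurableType d}
    (k : X -> probability (state T0 T) R) :
  (forall B, measurable B -> measurable_fun [set: X] (fun x => k x B)) ->
  measurable_fun [set: X] (fun x => decision_value A u (k x)).
Proof.
move=> mk; have [a [Aa dvE]] := utility_sequence.
(* [sups _ 0] is the supremum over the tail from index 0, that is, over the whole sequence. *)
rewrite (_ : (fun x => _) = (fun x => sups (fun j => \int[k x]_w u (a j) w) 0)).
  apply: measurable_fun_sups => [x _|j]; last first.
    exact: measurable_expected_utility.
  have [_ [K uK]] := hu.
  exists K => _ [j _ <-].
  have := @expected_utility_le (k x) K _ (Aa j) (fun w => uK _ w (Aa j)).
  by rewrite ler_norml => /andP[].
apply/funext => x; rewrite dvE /sups /sdrop; congr sup.
by apply/seteqP; split => [_ [j _ <-]|_ [j _ <-]]; exists j.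
Qed.

Lemma decision_value_le (nu : probability (state T0 T) R) (K : R) :
  (forall a w, A a -> `|u a w| <= K) -> `|decision_value A u nu| <= K.
Proof.
move=> uK; have VK a : A a -> `|\int[nu]_w u a w| <= K.
  by move=> Aa; apply: expected_utility_le => // w; exact: uK.
have [a Aa] := A0.
have ub : has_ubound [set \int[nu]_w u a w | a in A].
  by exists K => _ [b /VK + <-]; rewrite ler_norml => /andP[].
rewrite ler_norml; apply/andP; split.
  have := VK a Aa; rewrite ler_norml => /andP[Va _]; apply: le_trans Va _.
  by apply: ub_le_sup => //; exists a.
apply: ge_sup; first by exists (\int[nu]_w u a w), a.
by move=> _ [b /VK + <-]; rewrite ler_norml => /andP[].
Qed.

End separability.
End decision_values.

(** * Posteriors as conditional expectations *)

Section posteriors.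
Context {R : realType} {n : nat} {T0 : completePseudoMetricType R}.
Context {T : 'I_n -> completePseudoMetricType R}.
Hypothesis hT : forall i, polish (T i).
Context {post : posterior_system T0 T}.
Arguments post : clear implicits.
Hypothesis hpost : is_posterior_system post.
Implicit Types (mu : probability (state T0 T) R) (S : {set 'I_n}).

Local Notation proj := (@proj_on R n T0 T).

Lemma measurable_proj_preimage S (C : set (substate T S)) : measurable C ->
  measurable (proj S @^-1` C).
Proof.
by move=> mC; rewrite -[X in measurable X]setTI; exact: measurable_proj_on.
Qed.

Lemma measurable_post_integral mu S (f : state T0 T -> \bar R) :
  (forall w, 0 <= f w)%E -> measurable_fun [set: state T0 T] f ->
  measurable_fun [set: substate T S] (fun x => \int[post mu S x]_w f w)%E.
Proof.
move=> f0 mf; apply: measurable_fun_integral_kernel => // B mB.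
exact: (hpost mu S).1.
Qed.

Lemma post_integral mu S (C : set (substate T S)) (f : state T0 T -> \bar R) :
  (forall w, 0 <= f w)%E -> measurable_fun [set: state T0 T] f ->
  measurable C ->
  (\int[mu]_(w in proj S @^-1` C) \int[post mu S (proj S w)]_v f v =
   \int[mu]_(w in proj S @^-1` C) f w)%E.
Proof.
move=> f0 mf mC; have mpC := measurable_proj_preimage mC.
apply: ge0_integral_disintegration => // B mB; last exact: (hpost mu S).2.
exact: measurableT_comp ((hpost mu S).1 B mB) (@measurable_proj_on _ _ _ _ S).
Qed.

(** Almost sure uniqueness of conditional expectation given [proj S], with all measurable sets as
    the pi-system. *)
Lemma ae_eq_post_integral mu S (f g : state T0 T -> \bar R) :
  (forall w, 0 <= f w)%E -> measurable_fun [set: state T0 T] f ->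
  (forall w, 0 <= g w)%E -> measurable_fun [set: state T0 T] g ->
  (\int[mu]_w f w < +oo)%E ->
  (forall C, measurable C -> \int[mu]_(w in proj S @^-1` C) f w =
    \int[mu]_(w in proj S @^-1` C) g w)%E ->
  {ae mu, forall w, \int[post mu S (proj S w)]_v f v =
    \int[post mu S (proj S w)]_v g v}%E.
Proof.
move=> f0 mf g0 mg fin fg.
apply: (@ae_eq_pi_system _ _ _ _ _ mu (proj S) (@measurable_proj_on _ _ _ _ S)
  measurable _ _ _ (fun x => \int[post mu S x]_v f v)%E
  (fun x => \int[post mu S x]_v g v)%E).
- exact: measurableT.
- by move=> ? ? ? ?; exact: measurableI.
- by rewrite smallest_id//; exact: sigma_algebra_measurable.
- by move=> x; exact: integral_ge0.
- by move=> x; exact: integral_ge0.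
- exact: measurable_post_integral.
- exact: measurable_post_integral.
- have := @post_integral mu S setT f f0 mf measurableT.
  by rewrite preimage_setT => ->.
- by move=> C mC; rewrite !post_integral//; exact: fg.
Qed.

(** For each base set, the posterior probability of its preimage is almost surely the indicator at
    the observed value. Countably many base sets identify a point, so the posterior is concentrated
    on what was observed. *)
Lemma ae_post_proper mu S :
  {ae mu, forall w0, {ae post mu S (proj S w0),
    forall w, proj S w = proj S w0}}.
Proof.
have [B bB] := substate_base hT S.
have mB k : measurable (B k : set (substate T S)).
  by apply: sub_gen_smallest; exact: bB.1.
have mpB k := measurable_proj_preimage (mB k).
have : {ae mu, forall w0, forall k, post mu S (proj S w0) (proj S @^-1` B k) =
    (\1_(B k) (proj S w0))%:E}.
  apply: ae_foralln => k.
  apply: (@ae_eq_pi_system _ _ _ _ _ mu (proj S) (@measurable_proj_on _ _ _ _ S)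
    measurable _ _ _ (fun x => post mu S x (proj S @^-1` B k))
    (fun x => (\1_(B k) x)%:E)).
  - exact: measurableT.
  - by move=> ? ? ? ?; exact: measurableI.
  - by rewrite smallest_id//; exact: sigma_algebra_measurable.
  - by move=> x; exact: measure_ge0.
  - by move=> x; rewrite lee_fin.
  - exact: (hpost mu S).1.
  - by apply/measurable_EFinP; exact: measurable_indic.
  - have := (hpost mu S).2 _ setT (mpB k) measurableT.
    rewrite preimage_setT => ->.
    by rewrite -ge0_fin_numE// fin_num_measure// setTI.
  - move=> C mC; rewrite (hpost mu S).2//.
    have mpC := measurable_proj_preimage mC.
    by rewrite (@integral_indic _ _ _ mu _ mpC (proj S @^-1` B k))// setIC.
apply: filterS => w0 w0B.
have : {ae post mu S (proj S w0), forall w k,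
    B k (proj S w0) -> B k (proj S w)}.
  apply: ae_foralln => k.
  have [Bk|nBk] := pselect (B k (proj S w0)); last exact: aeW.
  exists (~` (proj S @^-1` B k)); split; first exact: measurableC.
    apply: etrans (probability_setC (post mu S (proj S w0)) (mpB k)) _.
    by rewrite w0B indicE mem_set// subee.
  by move=> w /= /not_implyP[].
apply: filterS => w; apply: base_sequence_point bB _.
exact: substate_accessible.
Qed.

End posteriors.

(** * Iterated conditioning *)

Section tower.
Context {R : realType} {n : nat} {T0 : completePseudoMetricType R}.
Context {T : 'I_n -> completePseudoMetricType R}.
Hypothesis hT : forall i, polish (T i).
Context {post : posterior_system T0 T}.
Arguments post : clear implicits.
Hypothesis hpost : is_posterior_system post.
Context (mu : probability (state T0 T) R) (i : 'I_n).

Local Notation proj := (@proj_on R n T0 T).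
Local Notation all := (finset.setT : {set 'I_n}).

(** [proj S] factors definitionally through [proj all] by this map, so events about some components
    are events about all of them. *)
Definition subproj (S : {set 'I_n})
    (z : prod_topology (fun k : {k : 'I_n | k \in all} => T (val k))) :
    prod_topology (fun k : {k : 'I_n | k \in S} => T (val k)) :=
  fun k => z (exist _ (val k) (finset.in_setT (val k))).

Lemma measurable_subproj (S : {set 'I_n}) :
  measurable_fun [set: substate T all] (@subproj S : _ -> substate T S).
Proof.
apply: (@borel_continuous_measurable
  (prod_topology (fun k : {k : 'I_n | k \in all} => T (val k)))
  (prod_topology (fun k : {k : 'I_n | k \in S} => T (val k))) _).
apply: continuous_prod_topology => k z.
exact: (@proj_continuous _ (fun k : {k : 'I_n | k \in all} => T (val k))
  (exist _ (val k) (finset.in_setT (val k))) z).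
Qed.

Lemma in_only : i \in only i. Proof. exact: finset.set11. Qed.

(** When the components other than [i] are known to be those of [w], this expresses all senders'
    components as a measurable function of component [i] alone. *)
Definition glue (w : T0 * prod_topology T)
    (y : prod_topology (fun k : {k : 'I_n | k \in only i} => T (val k))) :
    T0 * prod_topology T :=
  (w.1, dfwith w.2 i (y (exist _ i in_only))).

Lemma measurable_glue (w : state T0 T) :
  measurable_fun [set: substate T (only i)]
    (glue w : substate T (only i) -> state T0 T).
Proof.
apply: (@borel_continuous_measurable
  (prod_topology (fun k : {k : 'I_n | k \in only i} => T (val k)))
  (T0 * prod_topology T)%type _) => y.
pose Y := prod_topology (fun k : {k : 'I_n | k \in only i} => T (val k)).
have cd : (fun y : Y =>
    dfwith w.2 i (y (exist _ i in_only)) : prod_topology T) @ y -->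
    (dfwith w.2 i (y (exist _ i in_only)) : prod_topology T).
  apply: (@cvg_comp _ _ _ (fun y : Y => y (exist _ i in_only))
    (@dfwith _ T w.2 i)).
    exact: (@proj_continuous _
      (fun k : {k : 'I_n | k \in only i} => T (val k)) (exist _ i in_only) y).
  exact: (@dfwith_continuous _ T w.2 i).
move=> V [[P Q] [/= Pw Qw] PQ].
apply: (@filterS _ (nbhs y) _ _ _ _ (cd Q Qw)) => z Qz.
by apply: (PQ (w.1, _)); split => //=; exact: nbhs_singleton.
Qed.

Lemma proj_glue (w0 w : state T0 T) : proj (others i) w = proj (others i) w0 ->
  proj all (glue w0 (proj (only i) w)) = proj all w.
Proof.
move=> ww0; apply: functional_extensionality_dep => -[k kT].
rewrite /proj_on /=; have [->|ki] := eqVneq k i; first by rewrite dfwithin.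
rewrite dfwithout 1?eq_sym//.
have kO : k \in others i by rewrite finset.in_setC finset.in_set1.
by have /(congr1 (fun x => x (exist _ k kO))) := ww0.
Qed.

(* Given omega_{-i} = x, revealing omega_i reveals all the senders' components,
   so for almost every x the posterior of [post mu (others i) x] after omega_i
   agrees with the posterior of [mu] after all components. *)
Lemma ae_post_tower (f : state T0 T -> \bar R) (K : R) :
  (forall w, 0 <= f w <= K%:E)%E -> measurable_fun [set: state T0 T] f ->
  {ae mu, forall w0, {ae post mu (others i) (proj (others i) w0), forall w,
    \int[post (post mu (others i) (proj (others i) w0)) (only i)
           (proj (only i) w)]_v f v =
    \int[post mu all (proj all w)]_v f v}}%E.
Proof.
move=> fK mf; have f0 w : (0 <= f w)%E by have /andP[] := fK w.
have intK (nu : probability (state T0 T) R) (g : state T0 T -> \bar R) :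
    (forall w, 0 <= g w <= K%:E)%E -> measurable_fun setT g ->
    (0 <= \int[nu]_v g v <= K%:E)%E.
  move=> gK mg; apply/andP; split.
    by apply: integral_ge0 => w _; have /andP[] := gK w.
  rewrite -[leRHS](integral_cst_probability nu); apply: ge0_le_integral => //.
  - by move=> w _; have /andP[] := gK w.
  - by move=> w _; have /andP[] := gK w.
have [B bB] := substate_base hT (only i).
pose G := range (finI_sequence B).
have GM : G `<=` (measurable : set (set (substate T (only i)))).
  by rewrite (borel_finI_sequence bB); exact: sub_gen_smallest.
pose g w := (\int[post mu all (proj all w)]_v f v)%E.
have gK w : (0 <= g w <= K%:E)%E by exact: intK.
have g0 w : (0 <= g w)%E by have /andP[] := gK w.
have mg : measurable_fun [set: state T0 T] g.
  exact: measurableT_comp (measurable_post_integral hpost mu f0 mf)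
    (@measurable_proj_on _ _ _ _ all).
(* The exceptional set of [w0] must not depend on [C]; [unpickle] enumerates the pi-system, so
   countably many null sets merge into one. *)
have : {ae mu, forall w0 m,
    let C := finI_sequence B (odflt [::] (unpickle m)) in
    let nu := post mu (others i) (proj (others i) w0) in
    \int[nu]_(w in proj (only i) @^-1` C) g w =
    \int[nu]_(w in proj (only i) @^-1` C) f w}%E.
  apply: ae_foralln => m; set C := finI_sequence _ _.
  have mC : measurable (C : set (substate T (only i))).
    by apply: GM; exists (odflt [::] (unpickle m)).
  have mpC : measurable (proj (only i) @^-1` C) :=
    measurable_proj_preimage mC.
  have restrE h (D : set (state T0 T))
      (nu : {measure set (state T0 T) -> \bar R}) :
    (\int[nu]_(w in D) (h \_ (proj (only i) @^-1` C)) w =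
     \int[nu]_(w in D `&` proj (only i) @^-1` C) h w)%E.
    by rewrite integral_mkcondr.
  have restr h : (forall w, 0 <= h w <= K%:E)%E ->
      (forall w, 0 <= (h \_ (proj (only i) @^-1` C)) w <= K%:E)%E.
    move=> hK w; rewrite patchE; case: ifP => // _; rewrite lexx /=.
    by have /andP[] := hK w; exact: le_trans.
  have mrestr_ (h : state T0 T -> \bar R) : measurable_fun setT h ->
      measurable_fun setT (h \_ (proj (only i) @^-1` C)).
    by move=> mh; apply/(measurable_restrictT _ mpC); exact: measurable_funS mh.
  (* Restricting [g] and [f] to an event about component [i] keeps their integrals equal on events
     about the other components, because the intersection is an event about all components. *)
  have := @ae_eq_post_integral _ _ _ _ post hpost mu (others i)
    (g \_ (proj (only i) @^-1` C)) (f \_ (proj (only i) @^-1` C)).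
  case.
  - by move=> w; have /andP[] := restr g gK w.
  - exact: mrestr_.
  - by move=> w; have /andP[] := restr f fK w.
  - exact: mrestr_.
  - have /andP[_ iK] := intK mu _ (restr g gK) (mrestr_ g mg).
    exact: le_lt_trans iK (ltry _).
  - move=> D mD; rewrite !restrE.
    rewrite (_ : proj (others i) @^-1` D `&` proj (only i) @^-1` C =
      proj all @^-1` (subproj (S := others i) @^-1` D `&`
                      subproj (S := only i) @^-1` C)); last by [].
    apply: post_integral => //; apply: measurableI.
      by rewrite -[X in measurable X]setTI; exact: measurable_subproj.
    by rewrite -[X in measurable X]setTI; exact: measurable_subproj.
  move=> N [mN N0 subN]; exists N; split => // w /= nw; apply: subN => /=.
  by apply: contra_not nw; have := restrE g setT; have := restrE f setT;
    rewrite setTI => -> ->.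
move=> tower; have proper := ae_post_proper hT hpost mu (others i).
apply: filterS2 tower proper => w0.
set nu := post mu (others i) (proj (others i) w0) => tower nu0.
have nuC C : G C -> (\int[nu]_(w in proj (only i) @^-1` C) g w =
    \int[nu]_(w in proj (only i) @^-1` C) f w)%E.
  by move=> [l _ <-]; have := tower (pickle l); rewrite pickleK.
(* Under [nu] the other components are almost surely those of [w0], so [g] becomes a function of
   component [i], and uniqueness of conditional expectation given that component applies. *)
pose g2 (y : substate T (only i)) : \bar R :=
  (\int[post mu all (proj all (glue w0 y))]_v f v)%E.
have mg2 : measurable_fun [set: substate T (only i)] g2.
  exact: measurableT_comp mg (measurable_glue w0).
have gg2 : ae_eq nu setT g (g2 \o proj (only i)).
  by apply: filterS nu0 => w ww0 _; rewrite /g /g2/= proj_glue.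
have mg2p : measurable_fun [set: state T0 T] (g2 \o proj (only i)).
  exact: measurableT_comp mg2 (@measurable_proj_on _ _ _ _ _).
have := @ae_eq_pi_system _ _ _ _ _ nu (proj (only i))
  (@measurable_proj_on _ _ _ _ (only i)) G _ (@finI_sequence_pi _ B)
  (borel_finI_sequence bB) (fun y => \int[post nu (only i) y]_v f v)%E g2.
move=> H; have {H} : {ae nu, forall w,
    (\int[post nu (only i) (proj (only i) w)]_v f v)%E = g2 (proj (only i) w)}.
  apply: H.
  - exists [::] => //; by apply/seteqP; split.
  - by move=> y; exact: integral_ge0.
  - by move=> y; exact: integral_ge0.
  - exact: measurable_post_integral.
  - exact: mg2.
  - have /andP[_ iK] := intK nu
      (fun w => \int[post nu (only i) (proj (only i) w)]_v f v)%E
      (fun w => intK _ f fK mf)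
      (measurableT_comp (measurable_post_integral hpost nu f0 mf)
        (@measurable_proj_on _ _ _ _ _)).
    exact: le_lt_trans iK (ltry _).
  - move=> C GC; have mC := GM C GC.
    have mpC : measurable (proj (only i) @^-1` C) :=
      measurable_proj_preimage mC.
    rewrite (post_integral hpost nu f0 mf mC) -(nuC C GC).
    apply: ge0_ae_eq_integral; first exact: mpC.
    + exact: measurable_funS mg.
    + exact: measurable_funS mg2p.
    + by move=> w _; exact: g0.
    + by move=> w _; exact: integral_ge0.
    + exact: ae_eq_subset gg2.
by move: gg2; apply: filterS2 => w /(_ I) gw ->; exact: esym gw.
Qed.

End tower.

(** * A measurable version of the value of the last component *)

Section last_values.
Context {R : realType} {n : nat} {T0 : completePseudoMetricType R}.
Context {T : 'I_n -> completePseudoMetricType R}.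
Hypothesis hT : forall i, polish (T i).
Context {Act : completePseudoMetricType R} {A : set Act}.
Context {u : Act -> state T0 T -> R}.
Hypotheses (hu : utility_regular A u) (hAct : polish Act) (A0 : A !=set0).
Context {post : posterior_system T0 T}.
Arguments post : clear implicits.
Hypothesis hpost : is_posterior_system post.
Context (mu : probability (state T0 T) R) (i : 'I_n).

Local Notation proj := (@proj_on R n T0 T).
Local Notation all := (finset.setT : {set 'I_n}).

Lemma measurable_post_proj (nu : probability (state T0 T) R) (S : {set 'I_n})
    (B : set (state T0 T)) : measurable B ->
  measurable_fun [set: state T0 T] (fun w => post nu S (proj S w) B).
Proof.
move=> mB.
exact: measurableT_comp ((hpost nu S).1 B mB) (@measurable_proj_on _ _ _ _ S).
Qed.

(* [info_value] need not be measurable in the belief, since a posterior system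
   is only measurable in the observation; along the posteriors of a single
   belief it coincides almost surely with a measurable function. *)
Lemma info_value_given_version : exists (F : state T0 T -> R) (K : R),
  [/\ measurable_fun [set: state T0 T] F, forall w, `|F w| <= K
    & {ae mu, forall w,
        info_value_given A u post mu i (proj (others i) w) = F w}].
Proof.
have [_ [K uK]] := hu.
have [a [Aa dvE]] := utility_sequence hu hAct A0.
pose H w := decision_value A u (post mu all (proj all w)).
have mdv nu S : measurable_fun [set: state T0 T]
    (fun w => decision_value A u (post nu S (proj S w))).
  by apply: measurable_decision_value => // B; exact: measurable_post_proj.
have dvK nu : `|decision_value A u nu| <= K by exact: decision_value_le.
(* The version is the expected decision value under full revelation minus the present one; each term
   is bounded by [K]. *)
exists (fun w => \int[post mu (others i) (proj (others i) w)]_v H v -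
  decision_value A u (post mu (others i) (proj (others i) w))), (K + K).
split.
- apply: measurable_funB => //.
  apply: (@measurable_Rintegral_kernel _ _ _ H K) => //; first exact: mdv.
    by move=> w; exact: dvK.
  by move=> B mB; exact: (measurable_post_proj mu (others i) mB).
- move=> w; apply: le_trans (ler_normB _ _) _; apply: lerD => //.
  apply: (@le_norm_Rintegral_bound _ _ _ H K); first exact: mdv.
  by move=> v; exact: dvK.
(* Iterated conditioning is applied to countably many utilities, shifted by [K] into the interval
   from [0] to [K + K]; their suprema, the decision values, then agree as well. *)
have tower : {ae mu, forall w0 k,
    {ae post mu (others i) (proj (others i) w0), forall w,
    \int[post (post mu (others i) (proj (others i) w0)) (only i)
           (proj (only i) w)]_v (u (a k) v + K)%:E =
    \int[post mu all (proj all w)]_v (u (a k) v + K)%:E}}%E.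
  apply: ae_foralln => k; apply: (ae_post_tower hT hpost mu i (K := K + K)).
    move=> w; apply/andP; split; first by apply: shifted_ge0 => v; exact: uK.
    rewrite lee_fin lerD2r; have := uK _ w (Aa k).
    by rewrite ler_norml => /andP[].
  exact: (measurable_shifted K (measurable_utility hu (Aa k))).
apply: filterS tower => w0 tower; rewrite /info_value_given /info_value.
set nu := post mu (others i) (proj (others i) w0) in tower *.
have intE : (\int[nu]_w (decision_value A u
    (post nu (only i) (proj (only i) w)))%:E = \int[nu]_w (H w)%:E)%E.
  apply: ae_eq_integral; first exact: measurableT.
  - by apply/measurable_EFinP; exact: mdv.
  - by apply/measurable_EFinP; exact: mdv.
  have := ae_foralln tower; apply: filterS => w tw _; congr EFin.
  rewrite /H !dvE; apply: (congr1 (fun v : nat -> R => sup (range v))).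
  apply/funext => k.
  have uk v : `|u (a k) v| <= K := uK (a k) v (Aa k).
  have muk := measurable_utility hu (Aa k).
  by apply: (@addIr _ K); apply: EFin_inj; rewrite -!integral_shifted.
by rewrite /Rintegral intE.
Qed.

(** One measurable null set [N] covers both the failure of the version and the complement of the
    support, so that only [N] has to be followed through belief updates. *)
Lemma info_value_given_ae_bounds (c : R) :
  (forall x, marginal_support (others i) mu x ->
    c < info_value_given A u post mu i x) ->
  exists (F : state T0 T -> R) (K : R) (N : set (state T0 T)),
  [/\ measurable_fun [set: state T0 T] F, forall w, `|F w| <= K,
      measurable N, mu N = 0%E
    & forall w, ~ N w ->
        info_value_given A u post mu i (proj (others i) w) = F w /\ c < F w].
Proof.
move=> hc; have [F [K [mF FK FE]]] := info_value_given_version.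
have [N [mN N0 subN]] := filterI FE (ae_marginal_support hT (others i) mu).
exists F, K, N; split => // w; apply: contra_notP => nw.
apply: subN => /= -[Fw sw].
by apply: nw; rewrite Fw -[X in _ < X]Fw; split => //; exact: hc.
Qed.

End last_values.

(** * Bayesian updating *)

Section null_sets.
Context {d : measure_display} {X : measurableType d} {R : realType}.
Context (m : {measure set X -> \bar R}) (N : set X).
Hypotheses (mN : measurable N) (N0 : m N = 0%E).
Local Open Scope ereal_scope.
Import HBNNSimple.

(* The integrand of [expected_last_value] is only known to agree with a
   measurable function off a null set. *)
Lemma ge0_le_integral_off_null (f g : X -> \bar R) :
  (forall x, 0 <= f x) -> (forall x, 0 <= g x) ->
  (forall x, ~ N x -> f x = g x) -> \int[m]_x f x <= \int[m]_x g x.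
Proof.
move=> f0 g0 fg; rewrite !ge0_integralTE//.
apply: ge_ereal_sup => _ [h hf <-].
(* A simple function below [f] is set to zero on [N]: it is then below [g] and has the same
   integral. As the integral is a supremum over simple functions, [f] and [g] may be
   nonmeasurable. *)
pose h' := proj_nnsfun h (measurableC mN).
have h'E x : h' x = (h x * \1_(~` N) x)%R by [].
apply: ereal_sup_ubound; exists h' => [x|].
  rewrite h'E indicE; have [xN|xN] := boolP (x \in ~` N).
    by rewrite mulr1 -fg//; move/set_mem: xN.
  by rewrite mulr0.
rewrite -!integralT_nnsfun; apply: ge0_ae_eq_integral => //.
- exact/measurable_EFinP.
- exact/measurable_EFinP.
- by move=> x _; rewrite lee_fin.
- by move=> x _; rewrite lee_fin.
exists N; split => // x /= hx; apply: contrapT => Nx; apply: hx => _.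
by rewrite -[LHS]/(h' x)%:E h'E indicE mem_set// mulr1.
Qed.

Lemma integral_off_null (f g : X -> \bar R) :
  (forall x, ~ N x -> f x = g x) -> \int[m]_x f x = \int[m]_x g x.
Proof.
move=> fg; rewrite integralE [RHS]integralE; congr (_ - _); apply/eqP.
- by rewrite eq_le; apply/andP; split; apply: ge0_le_integral_off_null => //;
    move=> x Nx; rewrite !funeposE fg.
- by rewrite eq_le; apply/andP; split; apply: ge0_le_integral_off_null => //;
    move=> x Nx; rewrite !funenegE fg.
Qed.

End null_sets.

(** The left side is the tangent to [z |-> c / z] at [y]; its distance to the curve is an explicit
    nonnegative fraction. *)
Lemma tangent_line {R : realType} (c y z : R) : 0 < c -> 0 < y -> 0 < z ->
  2 * c / y - c / y ^+ 2 * z <= c / z.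
Proof.
move=> c0 y0 z0; rewrite -subr_ge0.
rewrite [X in 0 <= X](_ : _ = c * (y - z) ^+ 2 / (z * y ^+ 2)).
  by apply: divr_ge0; apply: mulr_ge0; rewrite ?sqr_ge0// ltW.
by field; rewrite !gt_eqF.
Qed.

(** * Invariants along the path of play *)

Section histories.
Context {R : realType} {n : nat} {T0 : completePseudoMetricType R}.
Context {T : 'I_n -> completePseudoMetricType R}.
Context {Act : completePseudoMetricType R}.
Context {d : measure_display} {M : measurableType d}.
Context (s : forall i, sender_strategy T M i) (r : receiver_strategy T M Act).
Context (b : history T M -> probability (state T0 T) R).

(** A property that survives each consultation almost surely may be assumed of the history reached.
    It serves to carry the nullity of one fixed set along the beliefs. *)
Lemma almost_surely_after_invariant (J Q Q' : history T M -> Prop) :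
  (forall h, J h -> forall j, 0 < consult r h (offers_at s h) j ->
    {ae b h, forall w, {ae s j h (w.2 j), forall m,
      J ((offers_at s h, j, m) :: h)}}) ->
  (forall h, J h -> Q h -> Q' h) ->
  forall k h, J h -> almost_surely_after s r b Q k h ->
  almost_surely_after s r b Q' k h.
Proof.
move=> Jstep JQ; elim=> [|k IH] h Jh /=; first exact: JQ.
move=> Qh j cj.
apply: (@filterS2 _ _ (ae_filter_ringOfSetsType (b h)) _ _ _ _
  (Jstep h Jh j cj) (Qh j cj)) => w.
apply: (@filterS2 _ _ (ae_filter_ringOfSetsType (s j h (w.2 j)))) => m.
exact: IH.
Qed.

End histories.

(** * One update: belief [P], experiment [k], posterior [q] *)

Section bayes.
Context {d d' : measure_display} {X : measurableType d} {M : measurableType d'}.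
Context {R : realType} (P : probability X R).
Context (k : X -> {measure set M -> \bar R}).
Context (q : M -> probability X R).
Hypotheses (k1 : forall x, k x [set: M] = 1%E)
  (mk : forall C, measurable C -> measurable_fun [set: X] (k ^~ C))
  (mq : forall B, measurable B -> measurable_fun [set: M] (fun m => q m B))
  (bayes : forall B C, measurable B -> measurable C ->
    (\int[P]_x \int[k x]_(m in C) q m B = \int[P]_(x in B) k x C)%E).

(** Martingale property of beliefs under the law of the message, from [bayes] with the whole message
    space as [C]. *)
Lemma ge0_integral_posterior (f : X -> \bar R) : (forall x, 0 <= f x)%E ->
  measurable_fun [set: X] f ->
  (\int[mixture P mk]_m \int[q m]_x f x = \int[P]_x f x)%E.
Proof.
move=> f0 mf; apply: ge0_integral_disintegration => // B mB.
rewrite ge0_integral_mixture//; last exact: mq.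
rewrite bayes// setTI; under eq_integral do rewrite k1.
by rewrite integral_cst// mul1e.
Qed.

(** The expected posterior probability of [N] is [P N = 0], and a nonnegative function with zero
    integral vanishes almost everywhere; this is used for the state and then for the message. *)
Lemma posterior_null (N : set X) : measurable N -> P N = 0%E ->
  {ae P, forall x, {ae k x, forall m, q m N = 0%E}}.
Proof.
move=> mN N0; have mQ : measurable (~` [set m | q m N = 0%E]).
  rewrite (_ : ~` _ = (fun m => q m N) @^-1` (~` [set 0%E])) //.
  rewrite -[X in measurable X]setTI; apply: mq => //.
  exact: measurableC.
have : ae_eq P setT (fun x => \int[k x]_m q m N)%E (cst 0%E).
  apply/(ae_eq_integral_abs P measurableT).
    by apply: measurable_fun_integral_kernel => //; exact: mq.
  under eq_integral do rewrite gee0_abs ?integral_ge0//.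
  rewrite bayes// (eq_integral (cst 1%E)) => [|x _]; last exact: k1.
  by rewrite integral_cst// mul1e.
apply: filterS => x /(_ I) kx.
have : ae_eq (k x) setT (fun m => q m N) (cst 0%E).
  apply/(ae_eq_integral_abs (k x) measurableT); first exact: mq.
  by under eq_integral do rewrite gee0_abs//.
by apply: filterS => m /(_ I).
Qed.

Variables (f F : X -> R) (c K : R) (N : set X).
Hypotheses (c0 : 0 < c) (mF : measurable_fun [set: X] F)
  (FK : forall x, `|F x| <= K) (mN : measurable N) (N0 : P N = 0%E)
  (fF : forall x, ~ N x -> f x = F x /\ c < F x).

(** A belief that gives [N] no mass cannot distinguish [f] from [F], and [F] exceeds [c] off [N]. *)
Lemma version_Rintegral (nu : probability X R) : nu N = 0%E ->
  \int[nu]_x f x = \int[nu]_x F x /\ c <= \int[nu]_x F x.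
Proof.
move=> nuN; split.
  rewrite /Rintegral (integral_off_null mN nuN (g := fun x => (F x)%:E))//.
  by move=> x /fF[->].
rewrite -(lerD2r K) -lee_fin -(integral_shifted mF FK).
rewrite -[leLHS](integral_cst_probability nu).
apply: ae_ge0_le_integral => //.
- move=> x _; have xK := FK (point : X); rewrite lee_fin addr_ge0//.
    exact: ltW.
  exact: le_trans xK.
- by move=> x _; exact: shifted_ge0.
- exact: measurable_shifted.
exists N; split => // x /= nx; apply: contrapT => Nx; apply: nx => _.
by rewrite lee_fin lerD2r ltW//; have [] := fF Nx.
Qed.

(* Jensen's inequality for [y |-> c / y], by integrating a tangent line. *)
Lemma reciprocal_submartingale :
  ((c / \int[P]_x f x)%:E <=
   \int[P]_x \int[k x]_m (c / \int[q m]_z f z)%:E)%E.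
Proof.
pose Y m := \int[q m]_z F z; set y := \int[P]_x F x.
have [-> cy] := version_Rintegral N0; rewrite -/y in cy *.
have y0 : 0 < y := lt_le_trans c0 cy.
have K0 : 0 <= K := le_trans (normr_ge0 _) (FK point).
(* A posterior that charges [N] may have [Y m] zero or negative. Truncation at [c] makes the
   reciprocal measurable and nonnegative everywhere, and changes nothing off the set [Q] below. *)
pose G m := c / Num.max c (Y m).
have mx0 m : 0 < Num.max c (Y m) by rewrite lt_max c0.
have G0 m : 0 <= G m by rewrite divr_ge0// ltW.
have mY : measurable_fun [set: M] Y :=
  measurable_Rintegral_kernel mF FK mq.
have mG : measurable_fun [set: M] G.
  have cG : continuous (fun x => c / Num.max c x).
    move=> x; apply: cvgMr; apply: cvgV; first by rewrite gt_eqF// lt_max c0.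
    by apply: continuous_max => //; exact: cvg_cst.
  exact: measurableT_comp (continuous_measurable_fun cG) mY.
have mEG : measurable_fun [set: M] (EFin \o G) by exact/measurable_EFinP.
pose Q := [set m | q m N != 0%E].
have mQ : measurable Q.
  rewrite (_ : Q = (fun m => q m N) @^-1` (~` [set 0%E])); last first.
    by apply/seteqP; split => m /eqP.
  rewrite -[X in measurable X]setTI; apply: mq => //.
  exact: measurableC.
have GY m : ~ Q m -> c / \int[q m]_z f z = G m /\ c <= Y m.
  move=> /negP; rewrite negbK => /eqP /version_Rintegral[-> cY]; split => //.
  by rewrite /G max_r.
have [W [mW W0 subW]] : {ae P, forall x, k x Q = 0%E}.
  have := posterior_null mN N0; apply: filterS => x [V [mV V0 subV]].
  apply/eqP; rewrite -measure_le0 -V0; apply: le_measure; rewrite ?inE//.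
  by move=> m /eqP Qm; apply: subV.
have -> : (\int[P]_x \int[k x]_m (c / \int[q m]_z f z)%:E =
    \int[mixture P mk]_m (G m)%:E)%E.
  rewrite ge0_integral_mixture//.
  apply: (integral_off_null mW W0) => x Wx.
  apply: (@integral_off_null _ _ _ (k x) Q) => //.
    by apply: contrapT => kQ; apply: Wx; exact: subW.
  by move=> m /GY[->].
have YK0 m : (0 <= (Y m + K)%:E)%E.
  have := le_norm_Rintegral_bound mF FK (q m).
  by rewrite ler_norml -/(Y m) lee_fin -lerBlDr sub0r => /andP[].
have mYK : measurable_fun [set: M] (fun m => (Y m + K)%:E).
  by apply/measurable_EFinP; exact: measurable_funD.
(* The slope of the tangent at [y], with its sign reversed. *)
pose B := c / y ^+ 2.
have B0 : 0 <= B by rewrite divr_ge0 ?sqr_ge0// ltW.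
have BE0 : (0 <= B%:E)%E by rewrite lee_fin.
have muT : mixture P mk setT = 1%E.
  rewrite /= /mixture; under eq_integral do rewrite k1.
  exact: integral_cst_probability.
have muQ : mixture P mk Q = 0%E.
  rewrite /= /mixture (integral_off_null mW W0 (g := cst 0%E)) ?integral0//.
  by move=> x Wx; apply: contrapT => kQ; apply: Wx; exact: subW.
(* The tangent inequality, with its linear term moved to the right and [B * K] added, has
   nonnegative sides and can be integrated off [Q]. *)
have : ((2 * c / y + B * K)%:E <=
    \int[mixture P mk]_m ((G m)%:E + B%:E * (Y m + K)%:E))%E.
  rewrite -[leLHS]mule1 -muT -integral_cst//; apply: ae_ge0_le_integral => //.
  - move=> m _; rewrite lee_fin; apply: addr_ge0; last exact: mulr_ge0.
    by apply: divr_ge0; [apply: mulr_ge0 => //|]; exact: ltW.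
  - by move=> m _; apply: adde_ge0; [rewrite lee_fin|apply: mule_ge0].
  - by apply: emeasurable_funD => //; exact: measurable_funeM.
  exists Q; split => // m /= nm; apply: contrapT => Qm; apply: nm => _.
  have [_ cY] := GY m Qm; rewrite -EFinM -EFinD lee_fin /G max_r//.
  have := tangent_line c0 y0 (lt_le_trans c0 cY); rewrite -/B; nra.
rewrite ge0_integralD//; last 3 first.
- by move=> m _; rewrite lee_fin.
- by move=> m _; exact: mule_ge0.
- exact: measurable_funeM.
rewrite ge0_integralZl//.
under [X in (_ + _ * X)%E]eq_integral do rewrite -(integral_shifted mF FK).
(* The mean of [Y] is [y] by the martingale property, so [2 * c / y - B * y = c / y] remains on the
   left. *)
rewrite ge0_integral_posterior; last 2 first.
- exact: shifted_ge0.
- exact: measurable_shifted.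
rewrite integral_shifted// -/y -EFinM.
rewrite -leeBlDr// -EFinB; congr (_ <= _)%E; congr EFin.
by rewrite /B; field; rewrite gt_eqF.
Qed.

End bayes.

Lemma measurable_message {R : realType} {n : nat}
    {T0 : completePseudoMetricType R} {T : 'I_n -> completePseudoMetricType R}
    {d : measure_display} {M : measurableType d} (j : 'I_n)
    (e : experiment T M j) (C : set M) : measurable C ->
  measurable_fun [set: state T0 T] (fun w => e (w.2 j) C).
Proof.
move=> mC; have mj : measurable_fun [set: state T0 T]
    ((fun w => w.2 j) : state T0 T -> borel (T j)).
  apply: (@borel_continuous_measurable
    (T0 * prod_topology T)%type (T j) _) => w.
  apply: (@cvg_comp _ _ _ snd (proj j)); first exact: cvg_snd.
  exact: (@proj_continuous _ T j w.2).
exact: measurableT_comp (measurable_kernel e C mC) mj.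
Qed.

(** * The submartingale property of the offers *)

Unset Implicit Arguments.

Theorem corollary1 (R : realType) (n : nat) (hn : (2 <= n)%N)
    (T0 : completePseudoMetricType R) (T : 'I_n -> completePseudoMetricType R)
    (hT0 : polish T0) (hT : forall i, polish (T i))
    (Act : completePseudoMetricType R) (hAct : polish Act)
    (A : set Act) (hA : closed A)
    (u : Act -> state T0 T -> R) (hu : utility_regular A u)
    (hopt : optimal_actions_exist A u)
    (d : measure_display) (M : measurableType d)
    (mu0 : probability (state T0 T) R)
    (post : posterior_system T0 T) (hpost : is_posterior_system post)
    (c : R) (c_gt0 : 0 < c)
    (hc : forall (i : 'I_n) (x : substate T (others i)),
       marginal_support (others i) mu0 x ->
       c < info_value_given A u post mu0 i x)
    (hsub : substitutes A u post mu0)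
    (s : forall i, sender_strategy T M i) (r : receiver_strategy T M Act)
    (b : history T M -> probability (state T0 T) R)
    (heq : aon_equilibrium post A u c mu0 s r b) :
  forall (i : 'I_n) (t : nat),
    almost_surely_after s r b (fun h => ~ revealed i h ->
      ((aon_prob A u post c mu0 i (b h))%:E <=
       expect_next s r b (fun h' => aon_prob A u post c mu0 i (b h')) h)%E)
      t [::].
Proof.
move=> i t; have [hequ hpath] := heq; have [_ [hr _] hb _ _] := hequ.
have [b0 hbayes _] := hb.
have A0 : A !=set0 by have [a Aa _] := hopt mu0; exists a.
have [F [K [N [mF FK mN N0 fF]]]] :=
  info_value_given_ae_bounds hT hu hAct A0 hpost (hc i).
(* [N] is null for the prior; the invariant keeps it null for every belief on the path, which
   preserves the lower bound [c] on the denominators. *)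
apply: (almost_surely_after_invariant (J := fun h => b h N = 0%E) _ _ _
  (hpath t)); last by rewrite b0.
- move=> h hN j _; have [mb bay] := hbayes h (offers_at s h) j.
  apply: (posterior_null (P := b h) (k := fun w => s j h (w.2 j))
    (q := fun m => b ((offers_at s h, j, m) :: h))) => //.
  + by move=> w; exact: prob_kernel.
  + by move=> C; exact: measurable_message.
move=> h hN [_ _ hstop] hi.
have consult0 j : 0 <= consult r h (offers_at s h) j.
  by have [] := hr h (offers_at s h).
(* With [i] unrevealed the receiver does not stop, so the consultation probabilities are weights;
   the inequality is then proved for each consulted sender [j] separately. *)
have consult1 : \sum_(j < n) consult r h (offers_at s h) j = 1.
  by apply/eqP; rewrite eq_sym -subr_eq0; apply/eqP; apply: hstop; exists i.
rewrite /expect_next -[leLHS]mul1e -consult1 -sumEFin.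
rewrite ge0_sume_distrl; last first.
  by move=> j _; rewrite lee_fin.
apply: lee_sum => j _; apply: lee_wpmul2l; first by rewrite lee_fin.
have [mb bay] := hbayes h (offers_at s h) j.
apply: (reciprocal_submartingale (P := b h) (k := fun w => s j h (w.2 j))
  (q := fun m => b ((offers_at s h, j, m) :: h))
  _ _ _ _ c_gt0 mF FK mN hN) => //.
+ by move=> w; exact: prob_kernel.
+ by move=> C; exact: measurable_message.
Qed.
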